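(* The single-objective BRT investment problem without component constraint, $\textsc{BRT*}(\textsc{Linear}/Z=\infty/|M|\ge1)$, can be solved in polynomial time if $c_e=1$ for all $e\in E$.
   Context: An instance consists of: a linear graph $G=(V,E)$ with $V=\{1,\dots,n\}$, $n\in\mathbb N_{\ge1}$ (stations) and $E=\{e_i=\{i,i+1\}: i\in\{1,\dots,n-1\}\}$ (segments); upgrade costs $c_e\in\mathbb N_{\ge1}$ for $e\in E$; a finite set $M$ of municipalities with pairwise disjoint sets $E_m\subseteq E$ of consecutive segments, $\bigcup_{m\in M}E_m=E$; budget shares $b_m\in\mathbb R_{>0}$ with $\sum_{m\in M}b_m=1$; a fixed budget $v\in\mathbb R_{\ge0}$; a set of OD pairs $D\subseteq\{(i,j):i,j\in V,i\neq j\}$, where $W_d\subseteq E$ denotes the edge set of the unique path from $i$ to $j$ in $G$ for $d=(i,j)\in D$; numbers of potential passengers $a_d\in\mathbb N_{\ge1}$ for $d\in D$; and infrastructure improvements $u_e\in\mathbb R_{>0}$ for $e\in E$. The problem is to maximize $p(F)=\sum_{d\in D}a_d\cdot\frac{\sum_{e\in F\cap W_d}u_e}{\sum_{e\in W_d}u_e}$ (passenger response Linear) over all $F\subseteq E$ such that $\sum_{e\in F\cap E_m}c_e\le b_m v$ for all $m\in M$. (''$Z=\infty$'' means that there is no constraint on the number of connected components of the subgraph induced by $F$.) *)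

(* Defs.v *)
From mathcomp Require Import all_boot all_order all_algebra.
From mathcomp Require Import boolp reals.

Set Implicit Arguments.
Unset Strict Implicit.
Unset Printing Implicit Defensive.

Import Order.TTheory GRing.Theory Num.Theory.

Local Open Scope ring_scope.

(* Stations and segments of the linear graph on n stations.  Stations are
   numbered from 0, and the segment k : 'I_n.-1 stands for {k, k + 1}. *)

Notation station n := 'I_n.
Notation segment n := 'I_n.-1.

Definition joins (n : nat) (k : segment n) (x y : station n) : bool :=
  ((x == k :> nat) && (y == k.+1 :> nat)) ||
  ((y == k :> nat) && (x == k.+1 :> nat)).

Definition adj (n : nat) : rel (station n) :=
  fun x y => [exists k : segment n, joins k x y].

(* [x :: s] is a path without repeated vertices from x to y. *)
Definition simple_path (n : nat) (x y : station n) (s : seq (station n)) :=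
  [/\ path (@adj n) x s, last x s = y & uniq (x :: s)].

Definition traverses (n : nat) (x : station n) (s : seq (station n))
    (k : segment n) : bool :=
  has (fun xy => joins k xy.1 xy.2) (zip (x :: s) s).

(* The edge set W_d of the unique simple path between the stations of d. *)
Definition route (n : nat) (d : station n * station n) : {set segment n} :=
  [set k | `[< exists2 s, simple_path d.1 d.2 s & traverses d.1 s k >]].

(* Municipalities are labelled by 'I_m.  A district may be empty: for n = 1
   there is no segment at all, while the positive shares must sum to 1.
   [pax] is only meaningful on [od]. *)
Record instance (F : realFieldType) := Instance {
  nb_st : nat;
  nb_mun : nat;
  cost : segment nb_st -> nat;
  district : 'I_nb_mun -> {set segment nb_st};
  share : 'I_nb_mun -> F;
  budget : F;
  od : {set station nb_st * station nb_st};
  pax : station nb_st * station nb_st -> nat;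
  impr : segment nb_st -> F;
  nb_st_gt0 : (0 < nb_st)%N;
  nb_mun_gt0 : (0 < nb_mun)%N;
  cost_gt0 : forall e, (0 < cost e)%N;
  district_disjoint :
    forall m1 m2, m1 != m2 -> [disjoint district m1 & district m2];
  district_consecutive : forall m (e1 e2 e : segment nb_st),
    e1 \in district m -> e2 \in district m -> (e1 <= e <= e2)%N ->
    e \in district m;
  district_cover : \bigcup_m district m = [set: segment nb_st];
  share_gt0 : forall m, 0 < share m;
  share_sum1 : \sum_m share m = 1;
  budget_ge0 : 0 <= budget;
  od_neq : forall d, d \in od -> d.1 != d.2;
  pax_gt0 : forall d, d \in od -> (0 < pax d)%N;
  impr_gt0 : forall e, 0 < impr e
}.

(* The objective p(S), for the linear passenger response. *)
Definition passengers (F : realFieldType) (I : instance F)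
    (S : {set segment (nb_st I)}) : F :=
  \sum_(d in od I) (pax d)%:R *
    ((\sum_(e in S :&: route d) impr e) / (\sum_(e in route d) impr e)).

Definition feasible (F : realFieldType) (I : instance F)
    (S : {set segment (nb_st I)}) : Prop :=
  forall m, (\sum_(e in S :&: district m) cost e)%N%:R <= share m * budget I.

Arguments passengers [F] I S.
Arguments feasible [F] I S.

Definition optimal (F : realFieldType) (I : instance F)
    (S : {set segment (nb_st I)}) : Prop :=
  feasible I S /\
  forall S', feasible I S' -> passengers I S' <= passengers I S.

Arguments optimal [F] I S.

Definition unit_costs (F : realFieldType) (I : instance F) : Prop :=
  forall e : segment (nb_st I), cost e = 1%N.

(* Random access machine with finitely many (unbounded, zero-initialised)
   arrays of natural numbers and finitely many arrays of elements of an ordered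
   field F, programmed by structured commands.  The first argument of a read
   or of an assignment is the name of an array, fixed in the program text.
   There is no rounding and no other passage from F to the natural numbers
   than the comparison of two elements of F. *)

Inductive nexp : Type :=
| NConst of nat
| NGet of nat & nexp
| NAdd of nexp & nexp
| NSub of nexp & nexp.

Inductive fexp : Type :=
| FZero
| FOne
| FGet of nat & nexp
| FAdd of fexp & fexp
| FSub of fexp & fexp
| FMul of fexp & fexp
| FDiv of fexp & fexp.

Inductive bexp : Type :=
| BLeN of nexp & nexp
| BLeF of fexp & fexp
| BNot of bexp
| BAnd of bexp & bexp.

Inductive cmd : Type :=
| Skip
| SetN of nat & nexp & nexp
| SetF of nat & nexp & fexp
| Seq of cmd & cmd
| If of bexp & cmd & cmd
| While of bexp & cmd.

Definition memory (T : Type) := nat -> nat -> T.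

Definition update (T : Type) (h : memory T) (a i : nat) (x : T) : memory T :=
  fun a' i' => if (a' == a) && (i' == i) then x else h a' i'.

Definition load (T : Type) (x0 : T) (arrays : seq (seq T)) : memory T :=
  fun a i => nth x0 (nth [::] arrays a) i.

Record state (F : Type) := State { nmem : memory nat; fmem : memory F }.

Definition bitlen (n : nat) : nat := (trunc_log 2 n).+1.

Fixpoint neval (F : Type) (s : state F) (e : nexp) : nat :=
  match e with
  | NConst n => n
  | NGet a i => nmem s a (neval s i)
  | NAdd e1 e2 => (neval s e1 + neval s e2)%N
  | NSub e1 e2 => (neval s e1 - neval s e2)%N
  end.

Fixpoint feval (F : realFieldType) (s : state F) (e : fexp) : F :=
  match e with
  | FZero => 0
  | FOne => 1
  | FGet a i => fmem s a (neval s i)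
  | FAdd e1 e2 => feval s e1 + feval s e2
  | FSub e1 e2 => feval s e1 - feval s e2
  | FMul e1 e2 => feval s e1 * feval s e2
  | FDiv e1 e2 => feval s e1 / feval s e2
  end.

Fixpoint beval (F : realFieldType) (s : state F) (e : bexp) : bool :=
  match e with
  | BLeN e1 e2 => (neval s e1 <= neval s e2)%N
  | BLeF e1 e2 => feval s e1 <= feval s e2
  | BNot e1 => ~~ beval s e1
  | BAnd e1 e2 => beval s e1 && beval s e2
  end.

(* Running time.  Every value that is read or computed is charged: a natural
   number its bit length, an element x of F the weight [w x]. *)

Fixpoint ntime (F : Type) (s : state F) (e : nexp) : nat :=
  (bitlen (neval s e) +
   match e with
   | NConst _ => 0
   | NGet _ i => ntime s i
   | NAdd e1 e2 | NSub e1 e2 => ntime s e1 + ntime s e2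
   end)%N.

Fixpoint ftime (F : realFieldType) (w : F -> nat) (s : state F) (e : fexp) :
    nat :=
  (w (feval s e) +
   match e with
   | FZero | FOne => 0
   | FGet _ i => ntime s i
   | FAdd e1 e2 | FSub e1 e2 | FMul e1 e2 | FDiv e1 e2 =>
       ftime w s e1 + ftime w s e2
   end)%N.

Fixpoint btime (F : realFieldType) (w : F -> nat) (s : state F) (e : bexp) :
    nat :=
  match e with
  | BLeN e1 e2 => (ntime s e1 + ntime s e2).+1
  | BLeF e1 e2 => (ftime w s e1 + ftime w s e2).+1
  | BNot e1 => (btime w s e1).+1
  | BAnd e1 e2 => (btime w s e1 + btime w s e2).+1
  end.

(* [exec w c s t s']: started in s, the command c halts in s' after time t. *)
Inductive exec (F : realFieldType) (w : F -> nat) :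
    cmd -> state F -> nat -> state F -> Prop :=
| ExecSkip s : exec w Skip s 1 s
| ExecSetN s a i e :
    exec w (SetN a i e) s (ntime s i + ntime s e).+1
      (State (update (nmem s) a (neval s i) (neval s e)) (fmem s))
| ExecSetF s a i e :
    exec w (SetF a i e) s (ntime s i + ftime w s e).+1
      (State (nmem s) (update (fmem s) a (neval s i) (feval s e)))
| ExecSeq c1 c2 s s1 s2 t1 t2 :
    exec w c1 s t1 s1 -> exec w c2 s1 t2 s2 ->
    exec w (Seq c1 c2) s (t1 + t2).+1 s2
| ExecIfT b c1 c2 s s1 t :
    beval s b -> exec w c1 s t s1 ->
    exec w (If b c1 c2) s (btime w s b + t).+1 s1
| ExecIfF b c1 c2 s s1 t :
    ~~ beval s b -> exec w c2 s t s1 ->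
    exec w (If b c1 c2) s (btime w s b + t).+1 s1
| ExecWhileF b c s :
    ~~ beval s b -> exec w (While b c) s (btime w s b).+1 s
| ExecWhileT b c s s1 s2 t1 t2 :
    beval s b -> exec w c s t1 s1 -> exec w (While b c) s1 t2 s2 ->
    exec w (While b c) s (btime w s b + t1 + t2).+1 s2.

(* The label of the district containing e; the default value 0 is never used,
   since the districts partition the segments. *)
Definition mun_of (F : realFieldType) (I : instance F)
    (e : segment (nb_st I)) : nat :=
  oapp (@nat_of_ord (nb_mun I)) 0%N [pick m | e \in district m].

(* Input: segments, municipalities and stations are listed in increasing order
   and the OD pairs in the order of [enum]. *)
Definition input (F : realFieldType) (I : instance F) : state F :=
  State
    (load 0%N [:: [:: nb_st I; nb_mun I; #|od I|];
                  [seq cost e | e <- enum (segment (nb_st I))];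
                  [seq mun_of e | e <- enum (segment (nb_st I))];
                  [seq nat_of_ord d.1 | d <- enum (od I)];
                  [seq nat_of_ord d.2 | d <- enum (od I)]])
    (load 0 [:: [:: budget I];
                [seq share m | m <- enum 'I_(nb_mun I)];
                [seq impr e | e <- enum (segment (nb_st I))];
                [seq (pax d)%:R | d <- enum (od I)]]).

Definition output_array : nat := 5.

Definition output (F : realFieldType) (n : nat) (s : state F) :
    {set segment n} :=
  [set e : segment n | nmem s output_array e != 0%N].

(* The OD pairs and the districts only refer to stations and municipalities,
   so that their bit length is polynomial in the quantity below. *)
Definition input_size (F : realFieldType) (w : F -> nat) (I : instance F) :
    nat :=
  (nb_st I + nb_mun I + #|od I|
   + \sum_(e : segment (nb_st I)) (bitlen (cost e) + w (impr e))
   + \sum_(m : 'I_(nb_mun I)) w (share m)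
   + w (budget I)
   + \sum_(d in od I) w (pax d)%:R)%N.

Definition solves_in_time (F : realFieldType) (w : F -> nat)
    (C : instance F -> Prop) (T : nat -> nat) (P : cmd) : Prop :=
  forall I : instance F, C I ->
    exists t s, [/\ exec w P (input I) t s,
                    (t <= T (input_size w I))%N
                  & optimal I (output (nb_st I) s)].

(* Two ways of charging an element of the field: arithmetic operations on reals
   at unit cost (real RAM), and the logarithmic cost of rationals, which is
   polynomially equivalent to the running time of a Turing machine. *)
Definition unit_weight (F : realFieldType) (x : F) : nat := 1.

Definition rat_weight (x : rat) : nat :=
  (bitlen `|numq x| + bitlen `|denq x|)%N.

(* Main.v *)
(* The objective is additive: p(S) is the sum over e in S of the value of e, the
   sum of a_d * u_e / (sum of u over W_d) over the OD pairs d whose route uses e.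
   With unit costs the districts do not interact, and in each one it is optimal
   to take as many of its most valuable segments as the budget share allows.
   Ranking the segments of a district by value, with ties broken by the index,
   the segment with r competitors ahead of it is taken iff r + 1 <= b_m * v, so
   that selection needs no sorting.

   For the logarithmic cost, the height |num| + |den| of a rational is
   submultiplicative under all four operations, hence its bit length is
   subadditive and grows only linearly along the sums. *)

Require Import Defs.
From mathcomp Require Import all_boot all_order all_algebra.
From mathcomp Require Import boolp reals.
From mathcomp Require Import zify.

Set Implicit Arguments.
Unset Strict Implicit.
Unset Printing Implicit Defensive.

Import Order.TTheory GRing.Theory Num.Theory.
Local Open Scope ring_scope.

(** * Greedy selection *)

Section Greedy.
Variables (F : realFieldType) (T : finType) (val : T -> F) (better : rel T).
Hypothesis val_ge0 : forall e, 0 <= val e.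
Hypothesis better_irr : irreflexive better.
Hypothesis better_trans : transitive better.
Hypothesis better_total : forall i j, i != j -> better i j || better j i.
Hypothesis better_val : forall i j, better i j -> val j <= val i.
Variables (A : {set T}) (x : F).

Definition ahead e := #|[set j in A | better j e]|.
Definition greedy := [set e in A | (ahead e).+1%:R <= x].

Lemma ahead_lt i j : i \in A -> better i j -> (ahead i < ahead j)%N.
Proof.
move=> iA ij; apply/proper_card/properP; split.
  apply/subsetP => k; rewrite !inE => /andP[-> ki] /=.
  exact: better_trans ki ij.
by exists i; rewrite !inE iA ?ij // better_irr.
Qed.

Lemma greedy_better i j : i \in A -> j \in greedy -> better i j -> i \in greedy.
Proof.
rewrite !inE => iA /andP[_ jx] ij; rewrite iA (le_trans _ jx) // ler_nat.
by rewrite ltnS ltnW ?ahead_lt.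
Qed.

(** Let e be a member of [greedy] with the most elements ahead of it. Every other member beats e, so
    there are at most [ahead e + 1] members, and this number is at most x because e itself was
    selected. *)
Lemma greedy_card : 0 <= x -> #|greedy|%:R <= x.
Proof.
move=> x0; have [->|[e0 e0B]] := set_0Vmem greedy; first by rewrite cards0.
case: (arg_maxnP (P := mem greedy) ahead e0B) => e eB e_max.
have : e \in greedy := eB; rewrite inE => /andP[eA ex]; apply: le_trans ex; rewrite ler_nat.
have sB : greedy \subset e |: [set j in A | better j e].
  apply/subsetP => j jB; rewrite !inE; have [//|jNe] := eqVneq j e.
  have := jB; rewrite inE => /andP[jA _]; rewrite jA /=.
  have /orP[//|ej] := better_total jNe.
  by have := e_max _ jB; rewrite /geq /= leqNgt ahead_lt.
by apply: leq_trans (subset_leq_card sB) _; rewrite cardsU1; case: (_ \notin _).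
Qed.

(** Exchange argument. The best element e of A that [greedy] leaves out is a threshold: [val e] is
    an upper bound for the values on [C :\: greedy] and a lower bound for those on [greedy :\: C],
    and the former set is no larger than the latter. *)
Lemma greedy_opt (C : {set T}) : C \subset A -> #|C|%:R <= x ->
  \sum_(e in C) val e <= \sum_(e in greedy) val e.
Proof.
move=> CA Cx; rewrite (big_setID greedy) [leRHS](big_setID C) /= setIC lerD2l.
(* If nothing of A is left out there is no threshold, but then C lies inside [greedy] and
   nonnegativity of the values suffices. *)
have [AB|[e0 e0D]] := set_0Vmem (A :\: greedy).
  have -> : C :\: greedy = set0.
    by apply/eqP; rewrite -subset0 -AB setSD.
  by rewrite big_set0 sumr_ge0.
case: (arg_minnP (P := mem (A :\: greedy)) ahead e0D) => e eD e_min.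
have /setDP[eA eB] := eD.
have ltx : x < (ahead e).+1%:R by rewrite ltNge; apply: contra eB; rewrite inE eA.
(* By the choice of e, everything in A that beats e has been selected. With [ltx] this gives
   [#|C| <= #|greedy|]. *)
have leB : (ahead e <= #|greedy|)%N.
  apply/subset_leq_card/subsetP => j; rewrite inE => /andP[jA je].
  apply: contraLR (ahead_lt jA je) => jB.
  by rewrite -leqNgt e_min // inE /= inE jB.
have leCB : (#|C :\: greedy| <= #|greedy :\: C|)%N.
  rewrite !cardsD setIC leq_sub2r // -ltnS (leq_trans _ (_ : (ahead e).+1 <= _)%N) //.
  by rewrite -(ltr_nat F) (le_lt_trans Cx).
apply: (@le_trans _ _ (\sum_(i in C :\: greedy) val e)).
  apply: ler_sum => i /setDP[iC iB]; have [->//|iNe] := eqVneq i e.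
  have iA := subsetP CA _ iC.
  have /orP[ie|/better_val//] := better_total iNe.
  have := ahead_lt iA ie; rewrite ltnNge e_min // inE /= !inE iA.
  by move: iB; rewrite inE iA => ->.
apply: (@le_trans _ _ (\sum_(i in greedy :\: C) val e)).
  by rewrite !sumr_const ler_wpMn2l.
apply: ler_sum => i /setDP[iB _].
have [->//|iNe] := eqVneq i e; have /orP[/better_val//|ei] := better_total iNe.
by rewrite (greedy_better eA iB ei) in eB.
Qed.

End Greedy.

(** * Routes in the linear graph *)

Lemma joins_sym n (k : segment n) : symmetric (joins k).
Proof. by move=> x y; rewrite /joins orbC. Qed.

Lemma adj_sym n : symmetric (@adj n).
Proof. by move=> x y; apply: eq_existsb => k; rewrite joins_sym. Qed.

Lemma adj_connected n (x y : station n) : connect (@adj n) x y.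
Proof.
wlog xy : x y / (x <= y)%N.
  move=> H; have [/H//|/ltnW/H] := leqP x y.
  by rewrite (sym_connect_sym (@adj_sym n)).
case: y xy => y yn /=; elim: y yn => [|y IH] yn.
  by rewrite leqn0 => /eqP x0; apply/eq_connect0/val_inj.
rewrite leq_eqVlt => /orP[/eqP xy|xy]; first exact/eq_connect0/val_inj.
apply: (connect_trans (IH (ltnW yn) xy)); apply/connect1/existsP.
have yn' : (y < n.-1)%N by case: (n) yn.
by exists (Ordinal yn'); rewrite /joins /= !eqxx.
Qed.

Lemma simple_path_exists n (x y : station n) : exists s, simple_path x y s.
Proof.
have /connectP[s xs ->] := adj_connected x y.
by case/shortenP: xs => s' xs' us' _; exists s'.
Qed.

(** Whether a station is at most k tells on which side of the segment k it lies; an edge of the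
    graph changes sides only if it is k itself. *)
Lemma joins_side n (k : segment n) (x y : station n) :
  adj x y -> ((x <= k) (+) (y <= k) = joins k x y)%N.
Proof.
rewrite /joins => /existsP[j]; rewrite /joins.
by move: (nat_of_ord j) (nat_of_ord x) (nat_of_ord y) (nat_of_ord k); lia.
Qed.

Lemma path_side n (k : segment n) (x : station n) s :
  path (@adj n) x s -> ~~ traverses x s k -> (x <= k)%N = (last x s <= k)%N.
Proof.
elim: s x => //= y s IH x /andP[xy ys].
rewrite /traverses /= negb_or -joins_side // negb_add => /andP[/eqP-> tr].
exact: IH.
Qed.

(** Serves to show that a simple path cannot cross a segment twice: a second crossing would revisit
    an end of the segment. *)
Lemma traverses_mem n (k : segment n) (x : station n) s :
  traverses x s k ->
  forall z : station n, (z == k :> nat) || (z == k.+1 :> nat) -> z \in x :: s.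
Proof.
elim: s x => //= y s IH x; rewrite /traverses /= => /orP[xy|tr] z zk; last first.
  by rewrite inE (IH y) ?orbT.
rewrite !inE -(inj_eq val_inj z x) -(inj_eq val_inj z y) orbA /=.
apply/orP; left; move: zk xy; rewrite /joins.
by move: (nat_of_ord k) (nat_of_ord x) (nat_of_ord y) (nat_of_ord z); lia.
Qed.

(** Each crossing of k switches sides and nothing else does; a simple path crosses k at most
    once. *)
Lemma simple_path_traverses n (k : segment n) (x y : station n) s :
  simple_path x y s -> traverses x s k = ((x <= k) (+) (y <= k))%N.
Proof.
case; elim: s x => [|z s IH] x /=.
  by move=> _ <- _; rewrite addbb.
case/andP=> xz zs yE /andP[xNs us].
have -> : traverses x (z :: s) k = joins k x z || traverses z s k by [].
rewrite -(joins_side k xz).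
have [tr|ntr] := boolP (traverses z s k); last first.
  by rewrite -yE orbF -(path_side zs ntr).
have := IH z zs yE us; rewrite tr => /esym zy; rewrite orbT.
(* The tail already traverses k and so contains both ends of k. If the first edge were k as well, x
   would occur again in the tail. *)
have : ~~ joins k x z.
  apply: contra xNs => xzk; apply: (traverses_mem tr).
  move: xzk; rewrite /joins.
  by move: (nat_of_ord k) (nat_of_ord x) (nat_of_ord z); lia.
rewrite -joins_side //; move: zy.
by case: (x <= k)%N (z <= k)%N (y <= k)%N => [] [] [].
Qed.

(** Turns the route into two comparisons that a program can evaluate. The direction from right to
    left relies on the existence of a simple path. *)
Lemma mem_route n (d : station n * station n) (k : segment n) :
  (k \in route d) = ((d.1 <= k) (+) (d.2 <= k))%N.
Proof.
rewrite inE; apply/asboolP/idP => [[s xys]|dk].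
  by rewrite (simple_path_traverses k xys).
have [s xys] := simple_path_exists d.1 d.2.
by exists s => //; rewrite (simple_path_traverses k xys).
Qed.

(** * Sizes of numbers *)

(** The exponent is a successor because [bitlen 0] is 1. *)
Lemma bitlen_le n k : (n < 2 ^ k.+1)%N -> (bitlen n <= k.+1)%N.
Proof.
have [->|n0] := posnP n; first by [].
move=> nk; rewrite /bitlen ltnS -ltnS -(ltn_exp2l _ _ (isT : 1 < 2)%N).
exact: leq_ltn_trans (trunc_logP _ n0) nk.
Qed.

Lemma ltn_bitlen n : (n < 2 ^ bitlen n)%N.
Proof. exact: trunc_log_ltn. Qed.

Lemma leq_bitlen m n : (m <= n)%N -> (bitlen m <= bitlen n)%N.
Proof. by move=> mn; rewrite ltnS leq_trunc_log. Qed.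

Lemma bitlen_leS n : (bitlen n <= n.+1)%N.
Proof. by apply: bitlen_le; rewrite ltnW // ltn_expl. Qed.

Lemma bitlenM m n : (bitlen (m * n) <= bitlen m + bitlen n)%N.
Proof.
apply: (@bitlen_le _ (trunc_log 2 m + bitlen n)).
by rewrite -[X in (2 ^ X)%N]/(bitlen m + bitlen n)%N expnD ltn_mul ?ltn_bitlen.
Qed.

Lemma bitlenD m n : (bitlen (m + n) <= bitlen m + bitlen n)%N.
Proof.
apply: (@bitlen_le _ (trunc_log 2 m + bitlen n)).
rewrite -[X in (2 ^ X)%N]/(bitlen m + bitlen n)%N expnD.
have := ltn_bitlen m; have := ltn_bitlen n.
move: (2 ^ _)%N (2 ^ _)%N => a b; nia.
Qed.

(* [size_of] measures an element of F in a way that is subadditive for all four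
   operations; [w] itself need not be. *)
Record tame (F : realFieldType) (w size_of : F -> nat) : Prop := Tame {
  tame0 : (size_of 0%R <= 1)%N;
  tame1 : (size_of 1%R <= 2)%N;
  tameD : forall x y, (size_of (x + y)%R <= size_of x + size_of y)%N;
  tameB : forall x y, (size_of (x - y)%R <= size_of x + size_of y)%N;
  tameM : forall x y, (size_of (x * y)%R <= size_of x + size_of y)%N;
  tameV : forall x y, (size_of (x / y)%R <= size_of x + size_of y)%N;
  tame_weight : forall x, (w x <= 2 * size_of x)%N;
  tame_size : forall x, (size_of x <= (w x).+1)%N }.

Lemma tame_unit (F : realFieldType) : tame (@unit_weight F) (fun=> 1%N).
Proof. by []. Qed.

(** * Heights of rationals *)

Definition height (x : rat) : nat := (`|numq x| + `|denq x|)%N.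

(** Reducing a fraction only divides both parts by a nonzero common factor, so any representation
    bounds the height from above. *)
Lemma height_frac (a b : int) : b != 0 ->
  (height (a%:~R / b%:~R) <= `|a| + `|b|)%N.
Proof.
move=> b0; rewrite /height; case: divqP b0 => // k x k0 _.
rewrite !abszM -mulnDr leq_pmull // absz_gt0.
exact: k0.
Qed.

Lemma heightE (x : rat) : exists a b : int,
  [/\ b != 0, x = a%:~R / b%:~R & height x = (`|a| + `|b|)%N].
Proof.
by exists (numq x), (denq x); rewrite divq_num_den denq_neq0.
Qed.

Lemma heightD x y : (height (x + y) <= height x * height y)%N.
Proof.
have [a [b [b0 -> ->]]] := heightE x; have [c [d [d0 -> ->]]] := heightE y.
rewrite addf_div ?intr_eq0 // -!intrM -intrD.
apply: leq_trans (height_frac _ _) _; first by rewrite mulf_neq0.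
rewrite abszM; have : (`|(a * d + c * b)%R| <= `|a| * `|d| + `|c| * `|b|)%N.
  by rewrite -!abszM; lia.
nia.
Qed.

Lemma heightN x : height (- x) = height x.
Proof. by rewrite /height numqN denqN abszN. Qed.

Lemma heightM x y : (height (x * y) <= height x * height y)%N.
Proof.
have [a [b [b0 -> ->]]] := heightE x; have [c [d [d0 -> ->]]] := heightE y.
rewrite mulf_div -!intrM.
apply: leq_trans (height_frac _ _) _; first by rewrite mulf_neq0.
rewrite !abszM; nia.
Qed.

Lemma heightV x : (height x^-1 <= height x)%N.
Proof.
have [->|x0] := eqVneq x 0; first by rewrite invr0.
rewrite {1}/height -[x in x^-1]divq_num_den invf_div.
rewrite [leqRHS]addnC; apply: height_frac.
by rewrite numq_eq0.
Qed.

Lemma tame_rat : tame rat_weight (fun x => bitlen (height x)).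
Proof.
split=> // [x y|x y|x y|x y|x|x].
- exact: leq_trans (leq_bitlen (heightD x y)) (bitlenM _ _).
- by rewrite -(heightN y); exact: leq_trans (leq_bitlen (heightD _ _)) (bitlenM _ _).
- exact: leq_trans (leq_bitlen (heightM x y)) (bitlenM _ _).
- apply: leq_trans (leq_bitlen (heightM x y^-1)) _.
  apply: leq_trans (bitlenM _ _) _; rewrite leq_add2l.
  exact/leq_bitlen/heightV.
- by rewrite /rat_weight mul2n -addnn leq_add // leq_bitlen // ?leq_addr ?leq_addl.
- exact: leq_trans (bitlenD _ _) (leqnSn _).
Qed.

(** * Timed executions *)

(** Coefficient of K in the value bound: if every cell is at most K, then e evaluates to at most
    [nval e * K]. *)
Fixpoint nval (e : nexp) : nat :=
  match e with
  | NConst n => n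
  | NGet _ _ => 1
  | NAdd e1 e2 | NSub e1 e2 => nval e1 + nval e2
  end.

(** Coefficient of K in the time bound; the successor comes from [bitlen n <= n.+1]. *)
Fixpoint ncost (e : nexp) : nat :=
  (nval e).+1 +
  match e with
  | NConst _ => 0
  | NGet _ i => ncost i
  | NAdd e1 e2 | NSub e1 e2 => ncost e1 + ncost e2
  end.

Fixpoint fval (e : fexp) : nat :=
  match e with
  | FZero | FGet _ _ => 1
  | FOne => 2
  | FAdd e1 e2 | FSub e1 e2 | FMul e1 e2 | FDiv e1 e2 => fval e1 + fval e2
  end.

(** The factor 2 is the one by which [size_of] bounds the weight in [tame_weight]. *)
Fixpoint fcost (e : fexp) : nat :=
  2 * fval e +
  match e with
  | FZero | FOne => 0
  | FGet _ i => ncost i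
  | FAdd e1 e2 | FSub e1 e2 | FMul e1 e2 | FDiv e1 e2 => fcost e1 + fcost e2
  end.

Fixpoint bcost (b : bexp) : nat :=
  match b with
  | BLeN e1 e2 => (ncost e1 + ncost e2).+1
  | BLeF e1 e2 => (fcost e1 + fcost e2).+1
  | BNot b1 => (bcost b1).+1
  | BAnd b1 b2 => (bcost b1 + bcost b2).+1
  end.

(* A time bound for runs on which all stored values have size at most K and
   every loop makes at most K iterations. *)
Fixpoint cbound (K : nat) (c : cmd) : nat :=
  match c with
  | Skip => 1
  | SetN _ i e => ((ncost i + ncost e) * K).+1
  | SetF _ i e => ((ncost i + fcost e) * K).+1
  | Seq c1 c2 => (cbound K c1 + cbound K c2).+1
  | If b c1 c2 => (bcost b * K + (cbound K c1 + cbound K c2)).+1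
  | While b c1 => K.+1 * (bcost b * K + cbound K c1).+1
  end.

(** * Polynomial time bounds *)

Definition is_polynomial (f : nat -> nat) : Prop :=
  exists q : {poly nat}, forall k, f k = q.[k].

Lemma polynomial_const c : is_polynomial (fun=> c).
Proof. by exists c%:P => k; rewrite hornerC. Qed.

Lemma polynomial_id : is_polynomial id.
Proof. by exists 'X => k; rewrite hornerX. Qed.

Lemma polynomialD f g : is_polynomial f -> is_polynomial g ->
  is_polynomial (fun k => f k + g k)%N.
Proof. by move=> [p fp] [q gq]; exists (p + q) => k; rewrite hornerD fp gq. Qed.

Lemma polynomialM f g : is_polynomial f -> is_polynomial g ->
  is_polynomial (fun k => f k * g k)%N.
Proof. by move=> [p fp] [q gq]; exists (p * q) => k; rewrite hornerM fp gq. Qed.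

Lemma polynomialS f : is_polynomial f -> is_polynomial (fun k => (f k).+1).
Proof.
move=> /(polynomialD (polynomial_const 1))[q fq].
by exists q => k; rewrite -fq.
Qed.

(** Works because [cbound] adds the bounds of the two branches of an [If] instead of taking their
    maximum, so only sums and products of K and constants occur. *)
Lemma polynomial_cbound K c :
  is_polynomial K -> is_polynomial (fun k => cbound (K k) c).
Proof.
move=> pK; have pKM m : is_polynomial (fun k => m * K k)%N.
  by apply: polynomialM => //; apply: polynomial_const.
elim: c => [|a i e|a i e|c1 p1 c2 p2|b c1 p1 c2 p2|b c1 p1] /=.
- exact: polynomial_const.
- exact: polynomialS.
- exact: polynomialS.
- exact/polynomialS/polynomialD.
- by apply/polynomialS/polynomialD => //; apply: polynomialD.
- by apply: polynomialM; apply/polynomialS => //; apply: polynomialD.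
Qed.

Lemma updateE T (h : memory T) a i x : update h a i x a i = x.
Proof. by rewrite /update !eqxx. Qed.

(** * Proof rules for bounded and timed runs *)

Section Runs.
Variables (F : realFieldType) (w size_of : F -> nat).
Hypothesis wT : tame w size_of.
Variable K : nat.
Hypothesis K2 : (2 <= K)%N.
Implicit Types s : state F.

Definition bounded s : Prop :=
  (forall a i, nmem s a i <= K)%N /\ (forall a i, size_of (fmem s a i) <= K)%N.

Lemma neval_bound s e : bounded s -> (neval s e <= nval e * K)%N.
Proof.
case=> sN _; elim: e => [n|a i _|e1 IH1 e2 IH2|e1 IH1 e2 IH2] /=.
- by rewrite leq_pmulr // ltnW.
- by rewrite mul1n.
- by rewrite mulnDl leq_add.
- by rewrite mulnDl (leq_trans (leq_subr _ _)) // (leq_trans IH1) ?leq_addr.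
Qed.

Lemma ntime_bound s e : bounded s -> (ntime s e <= ncost e * K)%N.
Proof.
move=> sK; have bl e' : (bitlen (neval s e') <= (nval e').+1 * K)%N.
  apply: leq_trans (bitlen_leS _) _; have := neval_bound e' sK.
  by rewrite mulSn; lia.
elim: e => [n|a i IH|e1 IH1 e2 IH2|e1 IH1 e2 IH2]; rewrite [ncost _]/= mulnDl;
  apply: leq_add; rewrite ?mulnDl ?leq_add //.
Qed.

Lemma feval_bound s e : bounded s -> (size_of (feval s e) <= fval e * K)%N.
Proof.
have [t0 t1 tD tB tM tV _ _] := wT.
case=> _ sF; elim: e => [| |a i|e1 IH1 e2 IH2|e1 IH1 e2 IH2|e1 IH1 e2 IH2|e1 IH1 e2 IH2] /=.
- by rewrite mul1n (leq_trans t0) // ltnW.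
- by rewrite (leq_trans t1) // leq_pmulr // ltnW.
- by rewrite mul1n.
- by rewrite mulnDl (leq_trans (tD _ _)) ?leq_add.
- by rewrite mulnDl (leq_trans (tB _ _)) ?leq_add.
- by rewrite mulnDl (leq_trans (tM _ _)) ?leq_add.
- by rewrite mulnDl (leq_trans (tV _ _)) ?leq_add.
Qed.

Lemma ftime_bound s e : bounded s -> (ftime w s e <= fcost e * K)%N.
Proof.
move=> sK; have bl e' : (w (feval s e') <= 2 * fval e' * K)%N.
  by rewrite (leq_trans (tame_weight wT _)) // -mulnA leq_mul2l feval_bound.
elim: e => [| |a i|e1 IH1 e2 IH2|e1 IH1 e2 IH2|e1 IH1 e2 IH2|e1 IH1 e2 IH2];
  rewrite [fcost _]/= mulnDl; apply: leq_add;
  rewrite ?ntime_bound // ?mulnDl ?leq_add //.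
Qed.

Lemma btime_bound s b : bounded s -> (btime w s b <= bcost b * K)%N.
Proof.
move=> sK; have K1 := ltnW K2.
elim: b => [e1 e2|e1 e2|b IH|b1 IH1 b2 IH2] /=; rewrite mulSn.
- by have := ntime_bound e1 sK; have := ntime_bound e2 sK; rewrite mulnDl; lia.
- by have := ftime_bound e1 sK; have := ftime_bound e2 sK; rewrite mulnDl; lia.
- lia.
- by rewrite mulnDl; lia.
Qed.

Definition setN s a i x : state F := State (update (nmem s) a i x) (fmem s).
Definition setF s a i x : state F := State (nmem s) (update (fmem s) a i x).

Lemma bounded_setN s a i x : bounded s -> (x <= K)%N -> bounded (setN s a i x).
Proof. by case=> sN sF xK; split=> // a' i'; rewrite /= /update; case: ifP. Qed.

Lemma bounded_setF s a i x :
  bounded s -> (size_of x <= K)%N -> bounded (setF s a i x).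
Proof. by case=> sN sF xK; split=> // a' i'; rewrite /= /update; case: ifP. Qed.

(** Total correctness with resources: the final memory must again be bounded, so that the time
    bounds apply to the command that follows. *)
Definition runs c s (Q : state F -> Prop) : Prop :=
  exists t s', [/\ exec w c s t s', (t <= cbound K c)%N, bounded s' & Q s'].

Lemma runs_weaken c s (P Q : state F -> Prop) :
  runs c s P -> (forall s', bounded s' -> P s' -> Q s') -> runs c s Q.
Proof.
by move=> [t [s' [ex tK sK Ps]]] PQ; exists t, s'; split=> //; apply: PQ.
Qed.

Lemma runs_skip s (Q : state F -> Prop) : bounded s -> Q s -> runs Skip s Q.
Proof. by move=> sK Qs; exists 1%N, s; split=> //; apply: ExecSkip. Qed.

Lemma runs_setN s a i e (Q : state F -> Prop) :
  bounded s -> (neval s e <= K)%N -> Q (setN s a (neval s i) (neval s e)) ->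
  runs (SetN a i e) s Q.
Proof.
move=> sK eK Qs; eexists _, _; split; first exact: ExecSetN.
- by rewrite /= ltnS mulnDl leq_add ?ntime_bound.
- exact: bounded_setN.
- exact: Qs.
Qed.

Lemma runs_setF s a i e (Q : state F -> Prop) :
  bounded s -> (size_of (feval s e) <= K)%N ->
  Q (setF s a (neval s i) (feval s e)) -> runs (SetF a i e) s Q.
Proof.
move=> sK eK Qs; eexists _, _; split; first exact: ExecSetF.
- by rewrite /= ltnS mulnDl leq_add ?ntime_bound ?ftime_bound.
- exact: bounded_setF.
- exact: Qs.
Qed.

Lemma runs_seq c1 c2 s (Q : state F -> Prop) :
  runs c1 s (fun s1 => runs c2 s1 Q) -> runs (Seq c1 c2) s Q.
Proof.
move=> [t1 [s1 [ex1 t1K _ [t2 [s2 [ex2 t2K s2K Qs]]]]]].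
exists (t1 + t2).+1, s2; split=> //; first exact: ExecSeq ex1 ex2.
by rewrite /= ltnS leq_add.
Qed.

Lemma runs_if b c1 c2 s (Q : state F -> Prop) :
  bounded s -> (beval s b -> runs c1 s Q) -> (~~ beval s b -> runs c2 s Q) ->
  runs (If b c1 c2) s Q.
Proof.
move=> sK r1 r2; have := btime_bound b sK; have [bs|bs] := boolP (beval s b) => tb.
  have [t [s' [ex tK s'K Qs]]] := r1 bs.
  exists (btime w s b + t).+1, s'; split=> //; first exact: ExecIfT.
  by rewrite /= ltnS leq_add // (leq_trans tK) ?leq_addr.
have [t [s' [ex tK s'K Qs]]] := r2 bs.
exists (btime w s b + t).+1, s'; split=> //; first exact: ExecIfF.
by rewrite /= ltnS leq_add // (leq_trans tK) ?leq_addl.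
Qed.

Lemma runs_while (N : nat) (J : nat -> state F -> Prop) b c s (Q : state F -> Prop) :
  (N <= K)%N -> bounded s -> J 0%N s ->
  (forall k s1, (k <= N)%N -> J k s1 -> beval s1 b = (k < N)%N) ->
  (forall k s1, (k < N)%N -> bounded s1 -> J k s1 -> runs c s1 (J k.+1)) ->
  (forall s1, bounded s1 -> J N s1 -> Q s1) ->
  runs (While b c) s Q.
Proof.
move=> NK sK J0 Jb Jc JQ.
(* Here d is the number of iterations left; [d.+1] also pays for the last, failing test. *)
suff H d k s1 : (d + k = N)%N -> bounded s1 -> J k s1 ->
    exists t s', [/\ exec w (While b c) s1 t s',
      (t <= d.+1 * (bcost b * K + cbound K c).+1)%N, bounded s' & J N s'].
  have [t [s' [ex tK s'K JN]]] := H N 0%N s (addn0 N) sK J0.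
  exists t, s'; split=> //; last exact: JQ.
  by rewrite (leq_trans tK) // leq_mul2r ltnS NK orbT.
elim: d k s1 => [|d IH] k s1.
  rewrite add0n => -> s1K JN; exists (btime w s1 b).+1, s1; split=> //.
    by apply: ExecWhileF; rewrite (Jb N) ?ltnn.
  by rewrite mul1n ltnS (leq_trans (btime_bound b s1K)) ?leq_addr.
move=> dk s1K Jk; have kN : (k < N)%N by rewrite -dk addSn ltnS leq_addl.
have [t1 [s2 [ex1 t1K s2K J2]]] := Jc k s1 kN s1K Jk.
have [|t2 [s3 [ex2 t2K s3K J3]]] := IH k.+1 s2 _ s2K J2; first by rewrite addnS.
exists (btime w s1 b + t1 + t2).+1, s3; split=> //.
  by apply: ExecWhileT ex1 ex2; rewrite (Jb k) ?(ltnW kN).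
have := btime_bound b s1K; rewrite mulSn; move: t2K.
by move: (d.+1 * _)%N => X; lia.
Qed.

Definition var (x : nat) : nexp := NGet x (NConst 0).

Definition for_ (x : nat) (n : nexp) (c : cmd) : cmd :=
  Seq (SetN x (NConst 0) (NConst 0))
      (While (BNot (BLeN n (var x)))
             (Seq c (SetN x (NConst 0) (NAdd (var x) (NConst 1))))).

(** The guard evaluates n anew in every round, so J has to fix its value. The body must preserve the
    counter, and J is required again only after the increment. *)
Lemma runs_for (N : nat) (J : nat -> state F -> Prop) x n c s (Q : state F -> Prop) :
  (N <= K)%N -> bounded s -> J 0%N (setN s x 0 0) ->
  (forall k s1, J k s1 -> neval s1 n = N) ->
  (forall k s1, (k < N)%N -> bounded s1 -> J k s1 -> nmem s1 x 0 = k ->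
    runs c s1 (fun s2 => nmem s2 x 0 = k /\ J k.+1 (setN s2 x 0 k.+1))) ->
  (forall s1, bounded s1 -> J N s1 -> Q s1) ->
  runs (for_ x n c) s Q.
Proof.
move=> NK sK J0 Jn Jc JQ; apply: runs_seq; apply: runs_setN => //=.
apply: (@runs_while N (fun k s1 => J k s1 /\ nmem s1 x 0 = k)) => //=.
- exact: bounded_setN.
- by rewrite updateE.
- by move=> k s1 _ [/Jn-> ->]; rewrite -ltnNge.
- move=> k s1 kN s1K [Jk xk]; apply: runs_seq.
  apply: runs_weaken (Jc k s1 kN s1K Jk xk) _ => s2 s2K [xk2 J2].
  apply: runs_setN => //=; rewrite xk2 addn1.
    exact: leq_trans kN NK.
  by rewrite updateE.
- by move=> s1 s1K [/JQ H _]; apply: H.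
Qed.

End Runs.

(** * The program *)

(* Array names beyond the input: natural arrays 6, 7, 8 hold the loop counters
   (at index 0); field array 4 holds the values of the segments and field array
   5 an accumulator (at index 0). *)
Definition at0 (a : nat) : fexp := FGet a (NConst 0).

Definition bxor (b1 b2 : bexp) : bexp :=
  BAnd (BNot (BAnd b1 b2)) (BNot (BAnd (BNot b1) (BNot b2))).

Definition nb_seg : nexp := NSub (NGet 0 (NConst 0)) (NConst 1).

(** By [mem_route], it suffices to test whether e separates the two stations of d; no path is ever
    built. *)
Definition on_route (d e : nexp) : bexp :=
  bxor (BLeN (NGet 3 d) e) (BLeN (NGet 4 d) e).

(** The OD pair is the current value of counter 7 of the enclosing loop. *)
Definition route_total : cmd :=
  Seq (SetF 5 (NConst 0) FZero)
      (for_ 8 nb_seg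
         (If (on_route (var 7) (var 8))
             (SetF 5 (NConst 0) (FAdd (at0 5) (FGet 2 (var 8))))
             Skip)).

Definition compute_values : cmd :=
  for_ 6 nb_seg
    (Seq (SetF 4 (var 6) FZero)
         (for_ 7 (NGet 0 (NConst 2))
            (If (on_route (var 7) (var 6))
                (Seq route_total
                     (SetF 4 (var 6)
                        (FAdd (FGet 4 (var 6))
                              (FMul (FGet 3 (var 7))
                                    (FDiv (FGet 2 (var 6)) (at0 5))))))
                Skip))).

Definition same_mun (i j : nexp) : bexp :=
  BAnd (BLeN (NGet 2 i) (NGet 2 j)) (BLeN (NGet 2 j) (NGet 2 i)).

(** Expressed with negation and conjunction only: j has a larger value than e, or a value at least
    as large and a smaller index. *)
Definition beats (j e : nexp) : bexp :=
  BNot (BAnd (BLeF (FGet 4 j) (FGet 4 e))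
             (BNot (BAnd (BNot (BLeN e j)) (BLeF (FGet 4 e) (FGet 4 j))))).

(** The rank is counted in the field, since it is to be compared with a budget and naturals cannot
    be converted. It starts at 1 to account for the segment itself. *)
Definition compute_rank : cmd :=
  Seq (SetF 5 (NConst 0) FOne)
      (for_ 8 nb_seg
         (If (BAnd (same_mun (var 8) (var 6)) (beats (var 8) (var 6)))
             (SetF 5 (NConst 0) (FAdd (at0 5) FOne))
             Skip)).

Definition select : cmd :=
  for_ 6 nb_seg
    (Seq compute_rank
         (If (BLeF (at0 5) (FMul (FGet 1 (NGet 2 (var 6))) (at0 0)))
             (SetN 5 (var 6) (NConst 1))
             (SetN 5 (var 6) (NConst 0)))).

Definition greedy_program : cmd := Seq compute_values select.

Lemma sum_nat_recr (V : nmodType) (P : pred nat) (f : nat -> V) k :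
  \sum_(0 <= j < k.+1 | P j) f j =
  \sum_(0 <= j < k | P j) f j + (if P k then f k else 0).
Proof. by rewrite !(big_mkcond P) big_nat_recr. Qed.

(** * Verification of the program on an arbitrary bounded memory *)

Section Program.
Variables (F : realFieldType) (w size_of : F -> nat).
Hypothesis wT : tame w size_of.
Variables (s0 : state F) (X : nat).
Hypothesis s0X : bounded size_of X s0.
Implicit Types s : state F.

(* A value is a sum of at most X terms a_d * (u_e / tot_d), each of size at most
   X + X + (X * X + 1). *)
Let K := (X * X.+1 ^ 2).+3.
Let N := (nmem s0 0 0 - 1)%N.
Let D := nmem s0 0 2.

Lemma size_sum (P : pred nat) (f : nat -> F) B k :
  (forall j, size_of (f j) <= B)%N ->
  (size_of (\sum_(0 <= j < k | P j) f j)%R <= (k * B).+1)%N.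
Proof.
move=> fB; elim: k => [|k IH]; first by rewrite big_nil (tame0 wT).
rewrite sum_nat_recr; case: (P k).
  by rewrite (leq_trans (tameD wT _ _)) // mulSn -addnS addnC leq_add.
by rewrite addr0 mulSn (leq_trans IH) // ltnS leq_addl.
Qed.

(** This and the following definitions up to [selected] specify the computed quantities in terms of
    the initial memory alone, without reference to an instance. The argument k of the partial sums
    is the number of loop rounds completed. *)
Definition crosses d e := ((nmem s0 3 d <= e) (+) (nmem s0 4 d <= e))%N.
Definition tot d k := \sum_(0 <= j < k | crosses d j) fmem s0 2 j.
Definition partial_value e k :=
  \sum_(0 <= d < k | crosses d e) fmem s0 3 d * (fmem s0 2 e / tot d N).
Definition value e := partial_value e D.
Definition outranks j e :=
  ~~ ((value j <= value e) && ~~ (~~ (e <= j)%N && (value e <= value j))).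
Definition competes j e := (nmem s0 2 j == nmem s0 2 e) && outranks j e.
Definition rank e k := 1 + \sum_(0 <= j < k | competes j e) (1 : F).
Definition selected e := rank e N <= fmem s0 1 (nmem s0 2 e) * fmem s0 0 0.

Lemma leXK : (X <= K)%N.
Proof. by rewrite /K; nia. Qed.

Lemma nb_seg_leX : (N <= X)%N.
Proof. by have [sN _] := s0X; apply: leq_trans (leq_subr _ _) (sN 0%N 0%N). Qed.

Lemma nb_od_leX : (D <= X)%N.
Proof. by have [sN _] := s0X; apply: sN. Qed.

Lemma nb_seg_leK : (N <= K)%N.
Proof. exact: leq_trans nb_seg_leX leXK. Qed.

Lemma nb_od_leK : (D <= K)%N.
Proof. exact: leq_trans nb_od_leX leXK. Qed.

Lemma size_tot d k : (k <= N)%N -> (size_of (tot d k) <= (X * X).+1)%N.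
Proof.
move=> kN; have [_ sF] := s0X.
apply: leq_trans (size_sum _ _ (sF 2)) _.
by rewrite ltnS leq_mul2r (leq_trans kN nb_seg_leX) orbT.
Qed.

Lemma size_partial_value e k : (k <= D)%N -> (size_of (partial_value e k) <= K)%N.
Proof.
move=> kD; have [_ sF] := s0X.
have fB d : (size_of (fmem s0 3 d * (fmem s0 2 e / tot d N))%R <= X.+1 ^ 2)%N.
  apply: leq_trans (tameM wT _ _) (leq_trans (leq_add (sF 3 d) _) _).
    exact: leq_trans (tameV wT _ _) (leq_add (sF 2 e) (size_tot d (leqnn N))).
  by rewrite -mulnn mulSn mulnS; lia.
apply: leq_trans (size_sum _ _ fB) _; do 2 apply: leqW.
by rewrite ltnS leq_mul2r (leq_trans kD nb_od_leX) orbT.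
Qed.

Lemma size_rank e k : (k <= N)%N -> (size_of (rank e k) <= K)%N.
Proof.
move=> kN; have := tame1 wT => s1; apply: leq_trans (tameD wT _ _) _.
have := leq_add s1 (size_sum (fun j => competes j e) k (fun=> s1)).
move=> /leq_trans; apply; have := leq_trans kN nb_seg_leX; rewrite /K -mulnn.
(* For X = 0 the inequality reads 2 + 1 <= 3, so the summand 3 in K is exactly what is needed. *)
by case: (X) => [|x]; nia.
Qed.

Definition frame (ns fs : seq nat) s s' : Prop :=
  (forall a, a \notin ns -> nmem s' a = nmem s a) /\
  (forall a, a \notin fs -> fmem s' a = fmem s a).

Lemma frame_refl ns fs s : frame ns fs s s.
Proof. by []. Qed.

Lemma frame_trans ns fs ns' fs' s s' s'' :
  {subset ns <= ns'} -> {subset fs <= fs'} ->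
  frame ns' fs' s s' -> frame ns fs s' s'' -> frame ns' fs' s s''.
Proof.
move=> nss fss [fN fF] [gN gF]; split=> a aN.
  by rewrite gN ?fN //; apply: contra aN; apply: nss.
by rewrite gF ?fF //; apply: contra aN; apply: fss.
Qed.

Lemma frame_setN ns fs s s' a i x :
  a \in ns -> frame ns fs s s' -> frame ns fs s (setN s' a i x).
Proof.
move=> ans [fN fF]; split=> // b bN; rewrite -fN //= /update.
by have [ba|//] := eqVneq b a; rewrite ba ans in bN.
Qed.

Lemma frame_setF ns fs s s' a i x :
  a \in fs -> frame ns fs s s' -> frame ns fs s (setF s' a i x).
Proof.
move=> afs [fN fF]; split=> // b bN; rewrite -fF //= /update.
by have [ba|//] := eqVneq b a; rewrite ba afs in bN.
Qed.

Lemma fmem_setN s a i x : fmem (setN s a i x) = fmem s.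
Proof. by []. Qed.

Lemma fmem_setF s a i x : fmem (setF s a i x) a i = x.
Proof. exact: updateE. Qed.

Lemma fmem_setF_neq s a i x i' :
  i' != i -> fmem (setF s a i x) a i' = fmem s a i'.
Proof. by move=> ii'; rewrite /= /update (negbTE ii') andbF. Qed.

Lemma nmem_setN_neq s a i x i' :
  i' != i -> nmem (setN s a i x) a i' = nmem s a i'.
Proof. by move=> ii'; rewrite /= /update (negbTE ii') andbF. Qed.

Local Notation runs := (runs w size_of K).
Local Notation bounded := (bounded size_of K).
(** Only the output, the counters, the segment values and the accumulator are ever written, so input
    cells can always be read off from [s0]. *)
Local Notation inputs := (frame [:: 5; 6; 7; 8] [:: 4; 5] s0).

Lemma beval_bxor s b1 b2 : beval s (bxor b1 b2) = beval s b1 (+) beval s b2.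
Proof. by rewrite /=; case: (beval s b1) (beval s b2) => [] []. Qed.

Lemma beval_on_route s d e : inputs s ->
  beval s (on_route d e) = crosses (neval s d) (neval s e).
Proof. by move=> [sN _]; rewrite beval_bxor /= !sN. Qed.

Lemma neval_nb_seg s : inputs s -> neval s nb_seg = N.
Proof. by move=> [sN _]; rewrite /= sN. Qed.

Lemma runs_route_total s : bounded s -> inputs s ->
  runs route_total s (fun s' =>
    frame [:: 8] [:: 5] s s' /\ fmem s' 5 0 = tot (nmem s 7 0) N).
Proof.
move=> sK s0s; apply: runs_seq; apply: runs_setF => //=.
  by rewrite (leq_trans (tame0 wT)).
set s1 := setF _ _ _ _.
pose J k s' := frame [:: 8] [:: 5] s s' /\ fmem s' 5 0 = tot (nmem s 7 0) k.
have s0J k s' : J k s' -> inputs s'.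
  by move=> [ss' _]; apply: frame_trans ss' => // a; rewrite !inE => ->; rewrite ?orbT.
apply: (@runs_for _ _ _ wT K isT N J) => //.
- exact: nb_seg_leK.
- by apply: bounded_setF => //; rewrite (leq_trans (tame0 wT)).
- split; first by apply/frame_setN/frame_setF/frame_refl.
  by rewrite fmem_setN fmem_setF /tot big_nil.
- by move=> k s' /s0J/neval_nb_seg.
move=> k s' kN s'K J'; have s0s' := s0J _ _ J'; case: J' => ss' s'5 s'8.
have s'7 : nmem s' 7 0 = nmem s 7 0 by case: ss' => ->.
have s'2 : fmem s' 2 = fmem s0 2 by case: s0s' => _ ->.
apply: runs_if => //; rewrite beval_on_route //= s'7 s'8 => on.
  have E : fmem s' 5 0 + fmem s' 2 k = tot (nmem s 7 0) k.+1.
    by rewrite /tot sum_nat_recr on s'5 s'2.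
  apply: runs_setF => //=; rewrite s'8 E.
    apply: leq_trans (size_tot _ kN) _; rewrite /K; nia.
  split=> //; split; first by apply/frame_setN/frame_setF.
  by rewrite fmem_setN fmem_setF.
apply: runs_skip => //; split=> //; split; first exact/frame_setN.
by rewrite /= s'5 /tot sum_nat_recr (negbTE on) addr0.
Qed.

Lemma runs_compute_values :
  runs compute_values s0 (fun s' =>
    inputs s' /\ forall e, (e < N)%N -> fmem s' 4 e = value e).
Proof.
have s0K : bounded s0.
  case: s0X => sN sF; split=> a i; first exact: leq_trans (sN a i) leXK.
  exact: leq_trans (sF a i) leXK.
pose J k s := inputs s /\ forall e, (e < k)%N -> fmem s 4 e = value e.
apply: (@runs_for _ _ _ wT K isT N J) => //.
- exact: nb_seg_leK.
- by split=> //; apply/frame_setN/frame_refl.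
- by move=> k s [/neval_nb_seg].
move=> e s eN sK [s0s sV] s6.
apply: runs_seq; apply: runs_setF => //=; first by rewrite (leq_trans (tame0 wT)).
rewrite s6.
pose J2 k s' := [/\ inputs s', nmem s' 6 0 = e,
  forall j, (j < e)%N -> fmem s' 4 j = value j & fmem s' 4 e = partial_value e k].
apply: (@runs_for _ _ _ wT K isT D J2) => //.
- exact: nb_od_leK.
- by apply: bounded_setF => //; rewrite (leq_trans (tame0 wT)).
- split=> //; first by apply/frame_setN/frame_setF.
    by move=> j je; rewrite fmem_setN fmem_setF_neq ?ltn_eqF ?sV.
  by rewrite fmem_setN fmem_setF /partial_value big_nil.
- by move=> k s' [[sN _] _ _ _]; rewrite /= sN.
- move=> d s1 dD s1K [s0s1 s16 s1V s1e] s17.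
  have s1F a : a \notin [:: 4; 5] -> fmem s1 a = fmem s0 a by case: s0s1 => _; apply.
  apply: runs_if => //; rewrite beval_on_route //= s17 s16 => on; last first.
    apply: runs_skip => //; split=> //; split=> //; first exact/frame_setN.
    by rewrite /= s1e /partial_value sum_nat_recr (negbTE on) addr0.
  apply: runs_seq; apply: runs_weaken (runs_route_total s1K s0s1) _.
  move=> s2 s2K [s1s2 s25].
  have s0s2 : inputs s2.
    by apply: frame_trans s1s2 => // a; rewrite !inE => ->; rewrite ?orbT.
  have s2F a : a \notin [:: 4; 5] -> fmem s2 a = fmem s0 a by case: s0s2 => _; apply.
  have s26 : nmem s2 6 0 = e by case: s1s2 => ->.
  have s27 : nmem s2 7 0 = d by case: s1s2 => ->.
  have s24 : fmem s2 4 = fmem s1 4 by case: s1s2 => _ ->.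
  have E : feval s2 (FAdd (FGet 4 (var 6)) (FMul (FGet 3 (var 7))
      (FDiv (FGet 2 (var 6)) (at0 5)))) = partial_value e d.+1.
    rewrite /= s26 s27 s24 s25 s1e !s2F // s17.
    by rewrite /partial_value sum_nat_recr on.
  apply: runs_setF => //; rewrite E; first exact: size_partial_value.
  rewrite /= s26 s27; split=> //; split=> //.
  + exact/frame_setN/frame_setF.
  + by move=> j je; rewrite fmem_setN fmem_setF_neq ?ltn_eqF // s24 s1V.
  + by rewrite fmem_setN fmem_setF.
move=> s1 s1K [s0s1 s16 s1V s1e]; split=> //; split; first exact/frame_setN.
by move=> j; rewrite ltnS leq_eqVlt => /orP[/eqP->|/s1V].
Qed.

Lemma runs_compute_rank s : bounded s -> inputs s ->
  (forall e, (e < N)%N -> fmem s 4 e = value e) -> (nmem s 6 0 < N)%N ->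
  runs compute_rank s (fun s' =>
    frame [:: 8] [:: 5] s s' /\ fmem s' 5 0 = rank (nmem s 6 0) N).
Proof.
move=> sK s0s sV eN; apply: runs_seq; apply: runs_setF => //=.
  by rewrite (leq_trans (tame1 wT)).
set s1 := setF _ _ _ _.
pose J k s' := frame [:: 8] [:: 5] s s' /\ fmem s' 5 0 = rank (nmem s 6 0) k.
have s0J k s' : J k s' -> inputs s'.
  by move=> [ss' _]; apply: frame_trans ss' => // a; rewrite !inE => ->; rewrite ?orbT.
apply: (@runs_for _ _ _ wT K isT N J) => //.
- exact: nb_seg_leK.
- by apply: bounded_setF => //; rewrite (leq_trans (tame1 wT)).
- split; first by apply/frame_setN/frame_setF/frame_refl.
  by rewrite fmem_setN fmem_setF /rank big_nil addr0.
- by move=> k s' /s0J/neval_nb_seg.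
move=> k s' kN s'K J'; have s0s' := s0J _ _ J'; case: J' => ss' s'5 s'8.
have s'6 : nmem s' 6 0 = nmem s 6 0 by case: ss' => ->.
have s'2 : nmem s' 2 = nmem s0 2 by case: s0s' => ->.
have s'4 : fmem s' 4 = fmem s 4 by case: ss' => _ ->.
apply: runs_if => //.
  (* The two comparisons of [same_mun] merge into the equality in [competes]; the remaining test is
     [outranks] verbatim. *)
  rewrite /= s'8 s'6 s'2 s'4 !sV // -eqn_leq => comp.
  have E : fmem s' 5 0 + 1 = rank (nmem s 6 0) k.+1.
    by rewrite /rank sum_nat_recr ifT // addrA s'5.
  apply: runs_setF => //=; rewrite E; first exact: size_rank.
  split=> //; split; first by apply/frame_setN/frame_setF.
  by rewrite fmem_setN fmem_setF.
rewrite /= s'8 s'6 s'2 s'4 !sV // -eqn_leq => comp.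
apply: runs_skip => //; split=> //; split; first exact/frame_setN.
by rewrite /= s'5 /rank sum_nat_recr ifN // addr0.
Qed.

Lemma runs_greedy_program :
  runs greedy_program s0 (fun s' =>
    forall e, (e < N)%N -> (nmem s' output_array e != 0%N) = selected e).
Proof.
apply: runs_seq; apply: runs_weaken runs_compute_values _ => s sK [s0s sV].
pose J k s' := [/\ inputs s', forall e, (e < N)%N -> fmem s' 4 e = value e &
  forall e, (e < k)%N -> (nmem s' output_array e != 0%N) = selected e].
apply: (@runs_for _ _ _ wT K isT N J) => //.
- exact: nb_seg_leK.
- by split=> //; apply: frame_setN.
- by move=> k s' [/neval_nb_seg].
- move=> e s1 eN s1K [s0s1 s1V s1out] s16.
  apply: runs_seq; apply: runs_weaken (runs_compute_rank s1K s0s1 s1V _) _.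
    by rewrite s16.
  move=> s2 s2K [s1s2]; rewrite s16 => s25.
  have s0s2 : inputs s2.
    by apply: frame_trans s1s2 => // a; rewrite !inE => ->; rewrite ?orbT.
  have s2F a : a \notin [:: 4; 5] -> fmem s2 a = fmem s0 a by case: s0s2 => _; apply.
  have s26 : nmem s2 6 0 = e by case: s1s2 => ->.
  have s22 : nmem s2 2 = nmem s0 2 by case: s0s2 => ->.
  have s2out : nmem s2 5 = nmem s1 5 by case: s1s2 => ->.
  have s24 : fmem s2 4 = fmem s1 4 by case: s1s2 => _ ->.
  (* Covers both branches at once: each writes some x to the output cell of e, and only whether x is
     zero matters. *)
  have fin x : (x != 0%N) = selected e ->
      nmem (setN s2 5 e x) 6 0 = e /\ J e.+1 (setN (setN s2 5 e x) 6 0 e.+1).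
    move=> xe; split=> //; split.
    + exact/frame_setN/frame_setN.
    + by move=> j jN; rewrite /= s24 s1V.
    + move=> j; rewrite ltnS leq_eqVlt => /orP[/eqP->|je].
        by rewrite -xe; congr (_ != _); apply: updateE.
      rewrite -(s1out j je) -s2out; congr (_ != _).
      by apply: (@nmem_setN_neq s2 5 e x); rewrite ltn_eqF.
  apply: runs_if => //=; rewrite s25 s26 s22 !s2F // => sel;
    apply: runs_setN => //=; rewrite s26; apply: fin; rewrite /selected.
    by rewrite sel.
  by rewrite (negbTE sel).
by move=> s1 _ [_ _].
Qed.

End Program.

(** * Correctness on instances *)

(** Cells beyond the end of a loaded array hold the default value, so a bound on the memory must
    cover that value too. *)
Lemma nth_prop (T : eqType) (P : T -> Prop) (x0 : T) s i :
  P x0 -> (forall x, x \in s -> P x) -> P (nth x0 s i).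
Proof.
move=> P0 Ps; have [si|si] := leqP (size s) i; first by rewrite nth_default.
exact/Ps/mem_nth.
Qed.

Lemma sum_nth_enum (V : nmodType) (T : finType) (A : {set T}) (P : pred nat)
    (f : nat -> V) (Q : pred T) (g : T -> V) :
  (forall x0 i, (i < #|A|)%N -> P i = Q (nth x0 (enum A) i)) ->
  (forall x0 i, (i < #|A|)%N -> f i = g (nth x0 (enum A) i)) ->
  \sum_(0 <= i < #|A| | P i) f i = \sum_(x in A | Q x) g x.
Proof.
move=> PQ fg; rewrite -big_enum_cond cardE; rewrite cardE in PQ fg.
(* T may be empty, so a default element for [nth] is available only once the enumeration is known to
   be nonempty. *)
case E : (enum A) => [|x0 s]; first by rewrite !big_nil.
rewrite -E (big_nth x0) [LHS]big_nat_cond [RHS]big_nat_cond.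
apply: eq_big => [i|i /andP[/andP[_ ilt] _]]; last exact: (fg x0).
by case: (ltnP i _) => // /(PQ x0)->.
Qed.

Section Instance.
Variables (F : realFieldType) (I : instance F).
Local Notation n := (nb_st I).
Local Notation s0 := (input I).

Lemma mem_district (e : segment n) m : (e \in district m) = (mun_of e == m).
Proof.
rewrite /mun_of; case: pickP => [m' em' /=|none].
  have [<-|m'm] := eqVneq m' m; first by rewrite em' eqxx.
  rewrite (inj_eq val_inj) (negbTE m'm).
  exact: disjointFr (district_disjoint m'm) em'.
have : e \in \bigcup_m district (i := I) m by rewrite district_cover inE.
by case/bigcupP => m' _ em'; have := none m'; rewrite /= em'.
Qed.

Lemma mun_of_lt (e : segment n) : (mun_of e < nb_mun I)%N.
Proof.
rewrite /mun_of; case: pickP => [m _ /=|_ /=]; first exact: ltn_ord.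
exact: nb_mun_gt0.
Qed.

Lemma input_mun (e : segment n) : nmem s0 2 e = mun_of e.
Proof. by rewrite /= /load /= (nth_map e) ?size_enum_ord // nth_ord_enum. Qed.

Lemma input_impr (e : segment n) : fmem s0 2 e = impr e.
Proof. by rewrite /= /load /= (nth_map e) ?size_enum_ord // nth_ord_enum. Qed.

Lemma input_share (m : 'I_(nb_mun I)) : fmem s0 1 m = share m.
Proof. by rewrite /= /load /= (nth_map m) ?size_enum_ord // nth_ord_enum. Qed.

Lemma input_route d0 i (e : segment n) : (i < #|od I|)%N ->
  crosses s0 i e = (e \in route (nth d0 (enum (od I)) i)).
Proof.
move=> iD; rewrite mem_route /crosses /= /load /=.
by rewrite !(nth_map d0) -?cardE.
Qed.

Definition seg_value (e : segment n) : F :=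
  \sum_(d in od I | e \in route d)
    (pax d)%:R * (impr e / \sum_(e' in route d) impr e').

Lemma input_tot d0 i : (i < #|od I|)%N ->
  tot s0 i (n - 1) = \sum_(e in route (nth d0 (enum (od I)) i)) impr e.
Proof.
move=> iD; rewrite /tot subn1 big_mkord.
apply: eq_big => [e|e _]; last exact: input_impr.
exact: input_route.
Qed.

Lemma input_value (e : segment n) : value s0 e = seg_value e.
Proof.
apply: sum_nth_enum => d0 i iD; first exact: input_route.
rewrite input_impr -(input_tot d0) //; congr (_ * _).
by rewrite /= /load /= (nth_map d0) -?cardE.
Qed.

Lemma seg_value_ge0 (e : segment n) : 0 <= seg_value e.
Proof.
rewrite sumr_ge0 // => d _; rewrite mulr_ge0 ?divr_ge0 ?(ltW (impr_gt0 _)) //.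
by rewrite sumr_ge0 // => e' _; rewrite ltW ?impr_gt0.
Qed.

(** Exchanging the sums over OD pairs and over segments shows that the objective is additive. *)
Lemma passengersE (S : {set segment n}) :
  passengers I S = \sum_(e in S) seg_value e.
Proof.
rewrite /passengers /seg_value.
under eq_bigr do rewrite mulr_suml mulr_sumr.
rewrite (exchange_big_dep (mem S)) /=; last by move=> d e _ /setIP[].
by apply: eq_bigr => e eS; apply: eq_bigl => d; rewrite inE eS.
Qed.

Lemma sum_districts (S : {set segment n}) (f : segment n -> F) :
  \sum_(e in S) f e = \sum_m \sum_(e in S :&: district m) f e.
Proof.
rewrite (exchange_big_dep (mem S)) /=; last by move=> m e _ /setIP[].
apply: eq_bigr => e eS; rewrite (big_pred1 (Ordinal (mun_of_lt e))) // => m.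
by rewrite inE eS mem_district /= eq_sym -val_eqE.
Qed.

Definition beats_seg : rel (segment n) := fun j e => outranks s0 j e.

(** A lexicographic order, by decreasing value and then increasing index; this makes it a strict
    total order even when values coincide. *)
Lemma beats_segE j e : beats_seg j e =
  (seg_value e < seg_value j) ||
  ((seg_value e <= seg_value j) && (j < e)%N).
Proof.
by rewrite /beats_seg /outranks !input_value negb_and negbK -ltNge -ltnNge andbC.
Qed.

Lemma beats_seg_irr : irreflexive beats_seg.
Proof. by move=> e; rewrite beats_segE ltxx ltnn andbF. Qed.

Lemma beats_seg_trans : transitive beats_seg.
Proof.
move=> j i k; rewrite !beats_segE.
case/orP=> [a|/andP[a b]] /orP[c|/andP[c d]]; apply/orP.
- by left; apply: lt_trans c a.
- by left; apply: le_lt_trans c a.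
- by left; apply: lt_le_trans c a.
- by right; rewrite (le_trans c a) (ltn_trans b d).
Qed.

Lemma beats_seg_total i j : i != j -> beats_seg i j || beats_seg j i.
Proof.
rewrite !beats_segE -(inj_eq val_inj) neq_ltn /=.
by case: ltgtP => //= _; rewrite orbC.
Qed.

Lemma beats_seg_value i j : beats_seg i j -> seg_value j <= seg_value i.
Proof. by rewrite beats_segE => /orP[/ltW|/andP[]]. Qed.

Lemma input_selected (e : segment n) m : e \in district m ->
  selected s0 e =
  ((ahead beats_seg (district m) e).+1%:R <= share m * budget I).
Proof.
move=> em; have := em; rewrite mem_district => /eqP eE.
rewrite /selected input_mun eE input_share; congr (_ <= _).
(* The leading 1 of [rank] is the successor on [ahead]. *)
rewrite /rank /= subn1 big_mkord -natr1 addrC; congr (_ + 1).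
rewrite -sumr_const; apply: eq_bigl => j.
by rewrite inE mem_district /competes !input_mun eE.
Qed.

Lemma selected_district m :
  [set e : segment n | selected s0 e] :&: district m =
  greedy beats_seg (district m) (share m * budget I).
Proof.
apply/setP => e; rewrite !inE andbC.
by case: (boolP (e \in district m)) => // /input_selected->.
Qed.

Lemma feasible_unit (S : {set segment n}) : unit_costs I ->
  feasible I S <-> forall m, #|S :&: district m|%:R <= share m * budget I.
Proof.
move=> c1; rewrite /feasible; split=> H m; move/(_ m): H;
  by under eq_bigr do rewrite c1; rewrite sum1_card.
Qed.

Lemma selected_optimal : unit_costs I ->
  optimal I [set e : segment n | selected s0 e].
Proof.
move=> c1; split.
  apply/feasible_unit => // m; rewrite selected_district.
  apply: greedy_card; [exact: beats_seg_irr|exact: beats_seg_trans|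
    exact: beats_seg_total|].
  by rewrite mulr_ge0 ?budget_ge0 ?(ltW (share_gt0 _)).
move=> S /feasible_unit-/(_ c1) feasS; rewrite !passengersE !sum_districts.
apply: ler_sum => m _; rewrite selected_district.
apply: greedy_opt; [exact: seg_value_ge0|exact: beats_seg_irr|
  exact: beats_seg_trans|exact: beats_seg_total|exact: beats_seg_value| |].
- exact: subsetIr.
- exact: feasS.
Qed.

Variables (w size_of : F -> nat).
Hypothesis wT : tame w size_of.

(** Natural cells are bounded by value, whereas [input_size] charges a cost only its bit length;
    unit costs bridge this gap. The successor comes from [tame_size]. *)
Lemma bounded_input : unit_costs I ->
  bounded size_of (input_size w I).+1 s0.
Proof.
move=> c1; set L := input_size w I.
have [nL mL dL] : [/\ n <= L, nb_mun I <= L & #|od I| <= L]%N.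
  by rewrite /L /input_size; split; lia.
have size_le x : (w x <= L)%N -> (size_of x <= L.+1)%N.
  by move=> xL; apply: leq_trans (tame_size wT x) _.
have size0 : (size_of 0%R <= L.+1)%N by apply: leq_trans (tame0 wT) _.
split=> a i; rewrite /= /load.
  apply: (@nth_prop _ (fun x => x <= L.+1)%N) => //.
  case: a => [|[|[|[|[|a]]]]] x /=.
  - by rewrite !inE => /or3P[] /eqP->; apply: leqW.
  - by case/mapP => e _ ->; rewrite c1.
  - by case/mapP => e _ ->; apply: leqW (leq_trans (ltnW (mun_of_lt e)) mL).
  - by case/mapP => d _ ->; apply: leqW (leq_trans (ltnW (ltn_ord _)) nL).
  - by case/mapP => d _ ->; apply: leqW (leq_trans (ltnW (ltn_ord _)) nL).
  - by rewrite nth_nil.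
apply: (@nth_prop _ (fun x => size_of x <= L.+1)%N) => //.
case: a => [|[|[|[|a]]]] x /=.
- rewrite inE => /eqP->; apply: size_le.
  by rewrite /L /input_size; lia.
- case/mapP => m _ ->; apply: size_le.
  by rewrite /L /input_size (bigD1 m) //=; lia.
- case/mapP => e _ ->; apply: size_le.
  by rewrite /L /input_size (bigD1 e) //=; lia.
- case/mapP => d; rewrite mem_enum => dD ->; apply: size_le.
  by rewrite /L /input_size [X in (_ + X)%N](bigD1 d) //=; lia.
- by rewrite nth_nil.
Qed.

End Instance.

(* The bound K on the stored values for inputs whose entries have size at most
   X = k + 1. *)
Definition memory_bound (k : nat) : nat := (k.+1 * k.+2 ^ 2).+3.

Lemma polynomial_memory_bound : is_polynomial memory_bound.
Proof.
have pS := polynomialS polynomial_id.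
by do 3 apply: polynomialS; apply: polynomialM => //;
  apply: polynomialM; apply: polynomialS.
Qed.

(** Neither the program nor the time bound depends on the field, the weight or [size_of], so a
    single polynomial serves both cost models. *)
Lemma greedy_program_solves (F : realFieldType) (w size_of : F -> nat) :
  tame w size_of ->
  solves_in_time w (@unit_costs F)
    (fun k => cbound (memory_bound k) greedy_program) greedy_program.
Proof.
move=> wT I c1; have s0X := bounded_input wT c1.
have [t [s [ex tK _ sel]]] := runs_greedy_program wT s0X.
exists t, s; split=> //.
suff -> : output (nb_st I) s = [set e : segment (nb_st I) | selected (input I) e].
  exact: selected_optimal.
by apply/setP => e; rewrite !inE sel //= subn1.
Qed.

Theorem lemma21 :
  exists (P : cmd) (q : {poly nat}),
    (forall R : realType,
       solves_in_time (@unit_weight R) (@unit_costs R) (fun k => q.[k]) P) /\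
    solves_in_time rat_weight (@unit_costs rat) (fun k => q.[k]) P.
Proof.
have [q qE] := polynomial_cbound greedy_program polynomial_memory_bound.
exists greedy_program, q.
have -> : (fun k => q.[k]) = (fun k => cbound (memory_bound k) greedy_program).
  by apply: funext => k; rewrite qE.
split=> [R|]; first exact: greedy_program_solves (tame_unit R).
exact: greedy_program_solves tame_rat.
Qed.
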